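(* For every Tychonoff space $X$: (1) $C_{c}(X)=C_{rc}(X)$ if and only if every closed $C$-compact subset of $X$ is compact; (2) $C_{rc}(X)=C_{u}(X)$ if and only if $X$ is pseudocompact.
   Context: $C(X)$ is the set of all continuous real-valued functions on $X$. A subset $A\subseteq X$ is a $C$-compact subset of $X$ if $f(A)$ is compact in $\mathbb{R}$ for every $f\in C(X)$. For a family $\lambda$ of non-empty subsets of $X$, the $\lambda$-open topology on $C(X)$ has as subbase all sets $[F,U]=\{f\in C(X): f(F)\subseteq U\}$ with $F\in\lambda$, $U\subseteq\mathbb{R}$ open. $C_c(X)$ and $C_{rc}(X)$ denote $C(X)$ with the $\lambda$-open topology where $\lambda$ is the collection of all non-empty compact subsets of $X$, respectively all non-empty $C$-compact subsets of $X$. $C_u(X)$ denotes $C(X)$ with the topology of uniform convergence on $X$, having basic neighborhoods $\{g\in C(X):\sup_{x\in X}|g(x)-f(x)|<\varepsilon\}$, $\varepsilon>0$, of $f\in C(X)$. Equality of these spaces means equality of topologies. *)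

(* Defs.v *)
From HB Require Import structures.
From mathcomp Require Import all_boot all_order all_algebra.
From mathcomp Require Import all_classical all_reals all_analysis.
Import Order.TTheory GRing.Theory Num.Theory numFieldNormedType.Exports.

Set Implicit Arguments.
Unset Strict Implicit.
Unset Printing Implicit Defensive.

Local Open Scope classical_set_scope.
Local Open Scope ring_scope.

Definition tychonoff_space (X : topologicalType) : Prop :=
  hausdorff_space X /\ completely_regular_space X.

(* The library phrases complete regularity with uniformities; this is its
   equivalence with separation by real-valued functions. *)
Lemma completely_regular_functionP (R : realType) (X : topologicalType) :
  completely_regular_space X <->
  forall (a : X) (B : set X), closed B -> ~ B a ->
    exists f : X -> R, [/\ continuous f, range f `<=` `[0, 1],
                           f a = 0 & forall x, B x -> f x = 1].
Proof.
split=> crX a B clB nBa.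
  have [f [cf f01 fa fB]] := (@uniform_separatorP X R _ _).1 (crX a B clB nBa).
  exists f; split=> // [|x Bx]; first by apply: fa; exists a.
  by apply: fB; exists x.
have [f [cf f01 fa fB]] := crX a B clB nBa.
apply/(@uniform_separatorP X R); exists f; split=> //.
  by move=> _ [_ -> <-].
by move=> _ [x Bx <-]; exact: fB.
Qed.

Definition pseudocompact_space (R : realType) (X : topologicalType) : Prop :=
  forall f : continuousType X R, bounded_fun f.

Definition C_compact (R : realType) (X : topologicalType) (A : set X) : Prop :=
  forall f : continuousType X R, compact (f @` A).

Definition set_open_subbase (X Y : topologicalType) (lambda : set (set X)) :
    set (set (continuousType X Y)) :=
  [set W | exists F (U : set Y), [/\ lambda F, open U &
                        W = [set f : continuousType X Y | f @` F `<=` U]] ].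

Definition set_open_topology (X Y : topologicalType) (lambda : set (set X)) :
  Type := continuousType X Y.
Arguments set_open_topology : clear implicits.

HB.instance Definition _ (X Y : topologicalType) (lambda : set (set X)) :=
  Choice.on (set_open_topology X Y lambda).
HB.instance Definition _ (X Y : topologicalType) (lambda : set (set X)) :=
  isSubBaseTopological.Build (set_open_topology X Y lambda)
    (@set_open_subbase X Y lambda) id.

Definition C_c (R : realType) (X : topologicalType) : topologicalType :=
  set_open_topology X R [set A | A !=set0 /\ compact A].

Definition C_rc (R : realType) (X : topologicalType) : topologicalType :=
  set_open_topology X R [set A | A !=set0 /\ C_compact R A].

Definition C_u (R : realType) (X : topologicalType) : topologicalType :=
  initial_topology (id : continuousType X R -> {uniform X -> R}).

(* C_c, C_rc and C_u share the carrier continuousType X R, so their topologies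
   can be compared with Leibniz equality. *)
Definition topology_of (T : topologicalType) : set (set T) := @open T.
Arguments topology_of : clear implicits.

(* The supremum is taken in the extended reals, so that an unbounded difference
   has supremum +oo. *)
Lemma nbhs_C_uE (R : realType) (X : topologicalType) (f : C_u R X)
    (W : set (C_u R X)) :
  nbhs f W <-> exists2 e : R, 0 < e &
    [set g : C_u R X |
      (ereal_sup [set `|(g : continuousType X R) x - (f : continuousType X R) x|%:E
                 | x in [set: X]] < e%:E)%E] `<=` W.
Proof.
pose h : continuousType X R -> {uniform X -> R} := id.
have nbhsE : nbhs f W <->
    exists2 E : set (R * R), entourage E &
      [set g : C_u R X | forall x, E ((f : continuousType X R) x,
                                      (g : continuousType X R) x)] `<=` W.
  split=> [[_ [[V oV <-] Vf VW]]|[E entE EW]].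
    have /uniform_nbhs[E [entE EV]] : nbhs (h f) V by exact: open_nbhs_nbhs.
    by exists E => // g Eg; apply: VW; apply: EV => x _; exact: Eg.
  apply: filterS EW _.
  have : nbhs (h f) [set g | forall x, setT x -> E (h f x, g x)].
    by apply/uniform_nbhs; exists E; split.
  move/(@initial_continuous _ _ h f) => hE.
  by apply: (@filterS _ (nbhs f) _ _ _ _ hE) => g Eg x; exact: Eg.
apply: (iff_trans nbhsE); split=> [[E /=]|[e e0 eW]].
  rewrite -entourage_ballE => -[e /= e0 eE] EW; exists e => // g /= ge.
  apply: EW => x; apply: eE; rewrite /ball/= distrC -lte_fin.
  by apply: le_lt_trans ge; apply: ereal_sup_ubound; exists x.
exists [set xy | ball xy.1 (e / 2) xy.2].
  by rewrite -entourage_ballE; exists (e / 2) => //=; rewrite divr_gt0.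
move=> g eg; apply: eW => /=.
apply: (@le_lt_trans _ _ (e / 2)%:E); last first.
  by rewrite lte_fin ltr_pdivrMr// ltr_pMr// ltr1n.
apply: ge_ereal_sup => _ [x _ <-]; rewrite lee_fin distrC ltW//.
exact: eg.
Qed.

(* Main.v *)
Require Import Defs.
From mathcomp Require Import all_boot all_order all_algebra.
From mathcomp Require Import all_classical all_reals all_analysis.
Import Order.TTheory GRing.Theory Num.Theory numFieldNormedType.Exports.
Local Open Scope classical_set_scope.
Local Open Scope ring_scope.

(** That one topology on C(X) is coarser than another is continuity of the
identity map, and set_open_continuous lets this be checked on subbasic
neighborhoods only. The consequences of an equality of topologies rest on set_open_nbhs_agree:
a neighborhood of f in a set-open topology constrains the functions only
on a finite union K of sets of the family, so it contains every g that agrees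
with f on K. In a Tychonoff space a point outside the closure of K is
separated from it by a continuous function, and this forces K to be large.

Part 1. A C-compact set A and its closure have the same image under every
continuous function, so they define the same subbasic sets; if closed
C-compact sets are compact, nothing is gained beyond the compact-open
topology. Conversely, if the topologies agree, the neighborhood of 0 given by
a C-compact closed set A and ]-1, 1[ contains every function vanishing on
some compact K; a point of A outside K would admit such
a function with value 1, so A is a closed subset of K.

Part 2. The image of a C-compact set is compact, so a uniformly small
perturbation keeps it inside a given open set: C_rc is always coarser
than C_u. If X is pseudocompact, every zero set is C-compact: a missing limit
value y of k on the zero set of h would make the inverse of |k - y| + |h|
continuous and unbounded. In particular f(X) is compact and the zero sets
where |f - p| <= r are C-compact, and finitely many of them control
the uniform distance to f. Conversely, if C_rc and C_u agree, the uniform unit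
ball around 0 contains all functions vanishing on some C-compact K; then K is
dense, so that f(X) = f(K) is compact for every f. *)

(** * Neighborhoods in set-open topologies *)

Lemma set_open_nbhs (X Y : topologicalType) (lambda : set (set X))
    (f : continuousType X Y) (A : set X) (U : set Y) :
  lambda A -> open U -> f @` A `<=` U ->
  nbhs (f : set_open_topology X Y lambda)
    [set g : continuousType X Y | g @` A `<=` U].
Proof.
move=> lA oU fAU.
apply: (@open_nbhs_nbhs (set_open_topology X Y lambda)); split => //.
set W := [set g | _].
exists [set W]; last by rewrite bigcup_set1.
by move=> _ ->; apply: (finI_from1 id); exists A, U.
Qed.

Lemma set_open_nbhs_sub (X Y : topologicalType) (lambda : set (set X))
    (F : set_system (continuousType X Y)) (f : continuousType X Y) :
  Filter F ->
  (forall (A : set X) (U : set Y), lambda A -> open U -> f @` A `<=` U ->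
     F [set g : continuousType X Y | g @` A `<=` U]) ->
  nbhs (f : set_open_topology X Y lambda) `<=` F.
Proof.
move=> FF Fsub W; rewrite nbhsE => -[_ [[B Bsub <-] [V BV Vf]] VW].
apply: filterS VW _.
have [D Dsub defV] := Bsub _ BV.
apply: (@filterS _ _ _ V); first by move=> g Vg; exists V.
rewrite -defV in Vf *.
apply: filter_bigI => i iD.
have := Dsub _ iD; rewrite inE => -[A [U [lA oU defi]]].
by have := Vf _ iD; rewrite defi; exact: Fsub.
Qed.

(** A base neighborhood is a finite intersection of subbasic ones, and the union
K of the sets involved is kept within any class P stable under finite unions.
Abstracting P gives a compact K or a C-compact K from a single statement: the
sets of functions agreeing with f on a member of P form the base of a filter,
and that filter contains the subbasic neighborhoods of f. *)
Lemma set_open_nbhs_agree (X Y : topologicalType) (lambda P : set (set X))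
    (f : continuousType X Y) (W : set (continuousType X Y)) :
  P set0 -> setU_closed P -> lambda `<=` P ->
  nbhs (f : set_open_topology X Y lambda) W ->
  exists2 K, P K & forall g : continuousType X Y, {in K, g =1 f} -> W g.
Proof.
move=> P0 PU lP.
pose F := filter_from P
  (fun K => [set g : continuousType X Y | {in K, g =1 f}]).
have FF : Filter F.
  apply: filter_from_filter => [|K L PK PL]; first by exists set0.
  exists (K `|` L); first exact: PU.
  by move=> g gf; split=> x; rewrite inE => xKL; apply: gf; rewrite inE;
    [left|right].
move=> /(@set_open_nbhs_sub _ _ _ F f FF) -[A U lA _ fAU|K PK KW].
  exists A; first exact: lP.
  by move=> g gf _ [x Ax <-]; rewrite gf ?inE//; apply: fAU; exists x.
by exists K => // g /KW.
Qed.

Lemma set_open_continuous (T X Y : topologicalType) (lambda : set (set X))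
    (h : T -> set_open_topology X Y lambda) :
  (forall (t : T) (A : set X) (U : set Y), lambda A -> open U ->
     (h t : continuousType X Y) @` A `<=` U ->
     \forall s \near t, (h s : continuousType X Y) @` A `<=` U) ->
  continuous h.
Proof. by move=> hsub t; apply: set_open_nbhs_sub => A U; exact: hsub. Qed.

(** The pointwise strict inequality only yields supremum <= e, whence the two
formulations describe the same neighborhoods up to halving e. *)
Lemma uniform_nbhsP (R : realType) (X : topologicalType)
    (f : continuousType X R) (W : set (continuousType X R)) :
  nbhs (f : C_u R X) W <->
  exists2 e : R, 0 < e &
    forall g : continuousType X R, (forall x, `|g x - f x| < e) -> W g.
Proof.
rewrite nbhs_C_uE; split=> -[e e0 eW].
  exists (e / 2); first by rewrite divr_gt0.
  move=> g gf; apply: eW => /=; apply: (@le_lt_trans _ _ (e / 2)%:E).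
    by apply: ge_ereal_sup => _ [x _ <-]; rewrite lee_fin ltW.
  by rewrite lte_fin ltr_pdivrMr// ltr_pMr// ltr1n.
exists e => // g /= ge; apply: eW => x; rewrite -lte_fin.
by apply: le_lt_trans ge; apply: ereal_sup_ubound; exists x.
Qed.

(** * C-compact sets *)

Lemma C_compact_compact (R : realType) (X : topologicalType) (A : set X) :
  compact A -> C_compact R A.
Proof.
move=> cA f; apply: continuous_compact => //.
by apply: continuous_subspaceT; exact: cts_fun.
Qed.

(** A continuous image of the closure lies in the closure of the image, and the
image is already closed, being compact. Hence A and its closure impose the same
constraints on functions. *)
Lemma C_compact_image_closure (R : realType) (X : topologicalType)
    (A : set X) (f : continuousType X R) :
  C_compact R A -> f @` closure A = f @` A.
Proof.
move=> cA; apply/seteqP; split; last exact: image_subset (@subset_closure _ A).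
have clfA : closed (f @` A) by apply: compact_closed (cA f); exact: Rhausdorff.
have clA : closed (f @^-1` (f @` A)).
  by apply: preimage_closed clfA => x _; exact: cts_fun.
move=> _ [x clAx <-]; have : closure (f @^-1` (f @` A)) x.
  by apply: closureS clAx; exact: preimage_image.
exact: clA.
Qed.

Lemma C_compact_closure (R : realType) (X : topologicalType) (A : set X) :
  C_compact R A -> C_compact R (closure A).
Proof. by move=> cA f; rewrite C_compact_image_closure. Qed.

Lemma C_compact0 (R : realType) (X : topologicalType) :
  C_compact R (set0 : set X).
Proof. by move=> f; rewrite image_set0; exact: compact0. Qed.

Lemma C_compactU (R : realType) (X : topologicalType) :
  setU_closed (@C_compact R X).
Proof. by move=> A B cA cB f; rewrite image_setU; exact: compactU. Qed.

Lemma tychonoff_separation (R : realType) (X : topologicalType)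
    (a : X) (K : set X) :
  tychonoff_space X -> closed K -> ~ K a ->
  exists2 g : continuousType X R, {in K, g =1 cst 0} & g a = 1.
Proof.
move=> [_ /(completely_regular_functionP R) crX] clK nKa.
have [f [cf _ fa fK]] := crX a K clK nKa.
have cg : continuous (fun x => 1 - f x).
  by move=> x; apply: continuousB; [exact: cst_continuous|exact: cf].
exists (mkcts cg); last by rewrite /= /mkcts fa subr0.
by move=> x; rewrite inE /= /mkcts => /fK ->; rewrite subrr.
Qed.

(** * Zero sets in pseudocompact spaces *)

Lemma pseudocompact_bounded (R : realType) (X : topologicalType)
    (f : continuousType X R) :
  pseudocompact_space R X -> exists2 M, 0 < M & forall x, `|f x| <= M.
Proof.
move=> pX; have [N [_ Nf]] := pX f.
exists (Num.max N 0 + 1); first by rewrite ltr_pwDr// le_max lexx orbT.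
by move=> x; apply: Nf => //; rewrite ltr_pwDr// le_max lexx.
Qed.

(** The image of a zero set under k is bounded, so only closedness is at stake.
If y is a limit of values of k on the zero set of h but is not attained there,
then |k - y| + |h| vanishes nowhere, while it takes arbitrarily small values:
its inverse is a continuous unbounded function. *)
Lemma pseudocompact_zero_set (R : realType) (X : topologicalType)
    (h : continuousType X R) :
  pseudocompact_space R X -> C_compact R (h @^-1` [set 0]).
Proof.
move=> pX k; set A := h @^-1` _.
have [N N0 kN] := pseudocompact_bounded _ _ k pX.
apply: (@subclosed_compact _ _ `[- N, N]); last 2 first.
- exact: segment_compact.
- by move=> _ [x _ <-]; rewrite /= in_itv/= -ler_norml.
move=> y clAy; apply: contrapT => nAy.
have u_gt0 x : 0 < `|k x - y| + `|h x|.
  rewrite lt_neqAle addr_ge0// andbT eq_sym paddr_eq0// !normr_eq0.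
  apply/negP => /andP[/eqP kxy /eqP hx0]; apply: nAy; exists x => //.
  by apply/eqP; rewrite -subr_eq0 kxy.
have cv : continuous (fun x => (`|k x - y| + `|h x|)^-1).
  move=> x; apply: (@continuousV R X (fun x => `|k x - y| + `|h x|)).
    by rewrite gt_eqF.
  apply: continuousD; (apply: continuous_comp; last exact: norm_continuous).
    by apply: continuousB; [exact: cts_fun|exact: cst_continuous].
  exact: cts_fun.
have [M M0 vM] := pseudocompact_bounded _ _ (mkcts cv) pX.
have Mi0 : 0 < M^-1 by rewrite invr_gt0.
have [z [[x Ax <-]]] := clAy _ (nbhsx_ballx y _ Mi0).
rewrite /ball/= distrC => kxy; have := vM x; rewrite /= /mkcts.
have hx0 : h x = 0 by [].
have := u_gt0 x; rewrite hx0 normr0 addr0 => u0.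
rewrite gtr0_norm ?invr_gt0// leNgt => /negP; apply.
by rewrite -[ltLHS]invrK ltf_pV2 // posrE invr_gt0.
Qed.

(** * Comparison of the topologies *)

Lemma C_c_le_C_rc (R : realType) (X : topologicalType) :
  continuous (id : C_rc R X -> C_c R X).
Proof.
apply: set_open_continuous => /= f A U [A0 cA] oU fAU.
by apply: set_open_nbhs => //; split=> //; exact: C_compact_compact.
Qed.

Lemma C_rc_le_C_c (R : realType) (X : topologicalType) :
  (forall A : set X, closed A -> C_compact R A -> compact A) ->
  continuous (id : C_c R X -> C_rc R X).
Proof.
move=> cX; apply: set_open_continuous => /= f A U [[a Aa] cA] oU fAU.
have : nbhs (f : C_c R X) [set g : continuousType X R | g @` closure A `<=` U].
  apply: set_open_nbhs => //; last by rewrite C_compact_image_closure.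
  split; first by exists a; exact: subset_closure.
  by apply: cX; [exact: closed_closure|exact: C_compact_closure].
by apply: filterS => g /=; rewrite C_compact_image_closure.
Qed.

(** The near-covering form of compactness of f(A) gives a single uniform radius:
around each value y in f(A) some ball of radius e lies in U, and functions
within e / 2 of f send the points with f(x) in the half ball into it. *)
Lemma C_compact_uniform_nbhs (R : realType) (X : topologicalType)
    (f : continuousType X R) (A : set X) (U : set R) :
  C_compact R A -> open U -> f @` A `<=` U ->
  nbhs (f : C_u R X) [set g : continuousType X R | g @` A `<=` U].
Proof.
move=> cA oU fAU.
have /compact_near_coveringP/(_ _ (nbhs (f : C_u R X))
  (fun (g : continuousType X R) y =>
     forall x, A x -> f x = y -> U (g x))) := cA f.
move=> /(_ _ _)/wrap[y /fAU Uy|].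
  have /nbhs_ballP[e/= e0 eU] : nbhs y U by exact: open_nbhs_nbhs.
  have e20 : 0 < e / 2 by rewrite divr_gt0.
  exists (ball y (e / 2), [set g : continuousType X R |
      forall x, `|g x - f x| < e / 2]).
    split; first exact: nbhsx_ballx.
    by apply/uniform_nbhsP; exists (e / 2).
  move=> [z g] [/= yz gf] x Ax fxz; apply: eU.
  rewrite (splitr e); apply: (ball_triangle yz).
  by rewrite -fxz /ball/= distrC.
rewrite near_simpl; apply: filterS => g gU _ [x Ax <-].
by apply: (gU (f x)) => //; exists x.
Qed.

Lemma C_rc_le_C_u (R : realType) (X : topologicalType) :
  continuous (id : C_u R X -> C_rc R X).
Proof.
apply: set_open_continuous => f A U [_ cA]; exact: C_compact_uniform_nbhs.
Qed.

Lemma pseudocompact_C_compact (R : realType) (X : topologicalType) :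
  pseudocompact_space R X -> C_compact R (setT : set X).
Proof.
move=> pX; have := pseudocompact_zero_set _ _ (cst 0) pX.
by congr (C_compact R _); apply/seteqP; split.
Qed.

(** The set is the zero set of max(0, |f - p| - r). *)
Lemma pseudocompact_band (R : realType) (X : topologicalType)
    (f : continuousType X R) (p r : R) :
  pseudocompact_space R X -> C_compact R [set x | `|f x - p| <= r].
Proof.
move=> pX.
have ch : continuous (fun x => Num.max 0 (`|f x - p| - r)).
  move=> x; apply: (@continuous_max R X (fun=> 0)); first exact: cst_continuous.
  apply: continuousB; last exact: cst_continuous.
  apply: continuous_comp; last exact: norm_continuous.
  by apply: continuousB; [exact: cts_fun|exact: cst_continuous].
have := pseudocompact_zero_set _ _ (mkcts ch) pX; congr (C_compact R _).
apply/seteqP; split=> x; rewrite /= /mkcts -subr_le0.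
  by move=> <-; rewrite le_max lexx orbT.
by move=> le0; apply/eqP; rewrite eq_maxl.
Qed.

(** Compactness of f(X), in near-covering form, localizes the estimate to values
of f close to one value p = f(a). There it follows from a single subbasic
condition: g maps the C-compact band |f - p| <= e / 4 into the ball of radius
e / 2 around p. *)
Lemma pseudocompact_uniform_nbhs (R : realType) (X : topologicalType)
    (f : continuousType X R) (e : R) : pseudocompact_space R X -> 0 < e ->
  nbhs (f : C_rc R X)
    [set g : continuousType X R | forall x, `|g x - f x| < e].
Proof.
move=> pX e0.
have e20 : 0 < e / 2 by rewrite divr_gt0.
have e40 : 0 < e / 2 / 2 by rewrite divr_gt0.
have e42 : e / 2 / 2 < e / 2 by rewrite ltr_pdivrMr// ltr_pMr// ltr1n.
have /compact_near_coveringP/(_ _ (nbhs (f : C_rc R X))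
  (fun (g : continuousType X R) y =>
     forall x, f x = y -> `|g x - f x| < e)) :=
  pseudocompact_C_compact _ _ pX f.
move=> /(_ _ _)/wrap[_ [a _ <-]|].
  set p := f a; pose A := [set x | `|f x - p| <= e / 2 / 2].
  exists (ball p (e / 2 / 2), [set g : continuousType X R |
      g @` A `<=` ball p (e / 2)]).
    split; first exact: nbhsx_ballx.
    apply: set_open_nbhs.
    - split; last exact: pseudocompact_band.
      by exists a; rewrite /A/= subrr normr0 ltW.
    - exact: ball_open.
    - move=> _ [x xA <-]; rewrite /ball/= distrC.
      exact: le_lt_trans xA e42.
  move=> [y g] [/= py gA] x fxy.
  have pfx : `|p - f x| < e / 2 / 2 by rewrite fxy.
  have pgx : `|p - g x| < e / 2.
    by apply: gA; exists x => //; rewrite /A/= distrC ltW.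
  rewrite (splitr e) distrC; apply: (le_lt_trans (ler_distD p _ _)).
  apply: ltrD => //; rewrite distrC; exact: lt_trans pfx e42.
rewrite near_simpl; apply: filterS => g gf x.
by apply: (gf (f x)) => //; exists x.
Qed.

Lemma C_u_le_C_rc (R : realType) (X : topologicalType) :
  pseudocompact_space R X -> continuous (id : C_rc R X -> C_u R X).
Proof.
move=> pX f W /uniform_nbhsP[e e0 eW].
exact: filterS eW (pseudocompact_uniform_nbhs _ _ f e pX e0).
Qed.

(** * Equality of the topologies *)

(** Neighborhoods in terms of the set of open sets, the form in which they can
be transported along an equality of topologies. *)
Lemma nbhs_topology_of (T : topologicalType) (t : T) (W : set T) :
  nbhs t W <-> exists V, [/\ topology_of T V, V t & V `<=` W].
Proof.
rewrite nbhsE; split=> [[V [oV Vt] VW]|[V [oV Vt VW]]]; first by exists V.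
by exists V.
Qed.

Theorem theorem4p15 (R : realType) (X : topologicalType) (tX : tychonoff_space X) :
  (topology_of (C_c R X) = topology_of (C_rc R X) <->
   forall A : set X, closed A -> C_compact R A -> compact A) /\
  (topology_of (C_rc R X) = topology_of (C_u R X) <-> pseudocompact_space R X).
Proof.
split; split.
- move=> eqT A clA cA.
  have [->|/set0P A0] := eqVneq A set0; first exact: compact0.
  pose z : continuousType X R := cst 0.
  have : nbhs (z : C_rc R X)
      [set g : continuousType X R | g @` A `<=` ball (0 : R) 1].
    apply: set_open_nbhs => //; first exact: ball_open.
    by move=> _ [x _ <-]; exact: ballxx.
  move/nbhs_topology_of; rewrite -eqT => /(nbhs_topology_of (C_c R X) z _).2.
  move=> /(@set_open_nbhs_agree _ _ _ compact)[||_ []//|K cK KW].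
  + exact: compact0.
  + exact: compactU.
  have clK : closed K by apply: compact_closed cK; have [] := tX.
  apply: (@subclosed_compact _ _ K) => // a Aa; apply: contrapT => nKa.
  have [g g0 ga] := tychonoff_separation R X a K tX clK nKa.
  have : ball (0 : R) 1 (g a) by apply: (KW g g0); exists a.
  by rewrite ga /ball/= sub0r normrN normr1 ltxx.
- move=> cX; apply/seteqP; split=> O.
  + by move/continuousP: (C_c_le_C_rc R X); exact.
  + by move/continuousP: (C_rc_le_C_c R X cX); exact.
- move=> eqT f.
  pose z : continuousType X R := cst 0.
  have : nbhs (z : C_u R X)
      [set g : continuousType X R | forall x, `|g x - z x| < 1].
    by apply/uniform_nbhsP; exists 1.
  move/nbhs_topology_of; rewrite -eqT => /(nbhs_topology_of (C_rc R X) z _).2.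
  move=> /(@set_open_nbhs_agree _ _ _ (@C_compact R X))[||_ []//|K cK KW].
  + exact: C_compact0.
  + exact: C_compactU.
  have dK a : closure K a.
    apply: contrapT => nKa.
    have [g g0 ga] := tychonoff_separation R X a _ tX (@closed_closure _ K) nKa.
    have gK : {in K, g =1 z}.
      by move=> x /set_mem Kx; apply/g0/mem_set; exact: subset_closure.
    by have := KW g gK a; rewrite ga subr0 normr1 ltxx.
  (* f(X) = f(closure K) = f(K) is compact, hence bounded. *)
  have [N [Nr Nf]] := compact_bounded (cK f).
  exists N; split=> // M NM x _; apply: (Nf M NM).
  by rewrite -C_compact_image_closure//; exists x.
- move=> pX; apply/seteqP; split=> O.
  + by move/continuousP: (C_rc_le_C_u R X); exact.
  + by move/continuousP: (C_u_le_C_rc R X pX); exact.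
Qed.
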